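(* For every integer $n\geq 1$, the equivariant inverse Kazhdan–Lusztig polynomial of the Boolean matroid $B_n$ with its natural $S_n$-action is $Q_{B_n}^{S_n}(t)=V_{(1^n)}$, the sign representation (in degree $0$).
   Context: An equivariant matroid $W\curvearrowright M$ is a matroid $M$ on a finite ground set $\mathcal{I}$ together with a finite group $W$ acting on $\mathcal{I}$ and preserving $M$. $\mathrm{VRep}(W)$ is the ring of virtual (complex) representations of $W$, and $\mathrm{VRep}(W)[t]$ the polynomial ring over it. Let $L(M)$ be the lattice of flats of $M$; for a flat $F$, $M_F$ (localization) is the matroid on $F$ whose lattice of flats is $\{G\in L(M): G\le F\}$, $M^F$ (contraction) is the matroid on $\mathcal{I}\setminus F$ whose lattice of flats is $\{G\in L(M):G\geq F\}$, and $W_F\subseteq W$ is the stabilizer of $F$. The equivariant characteristic polynomial is $H_M^W(t)=\sum_{i=0}^{\mathrm{rk} M}(-1)^i t^{\mathrm{rk} M-i}OS^W_{M,i}$, where $OS^W_{M,i}$ is the degree-$i$ part of the Orlik–Solomon algebra of $M$ with its induced $W$-action. The equivariant inverse Kazhdan–Lusztig polynomial $Q_M^W(t)\in\mathrm{VRep}(W)[t]$ is the unique assignment such that: (a) if $\mathrm{rk} M=0$, $Q_M^W(t)$ is the trivial representation in degree $0$; (b) if $\mathrm{rk} M>0$, $\deg Q_M^W(t)<\frac12\mathrm{rk} M$; (c) for every $W\curvearrowright M$, $$(-t)^{\mathrm{rk} M}Q_M^W(t^{-1})=\sum_{[F]\in L(M)/W}\mathrm{Ind}_{W_F}^{W}\Big((-1)^{\mathrm{rk}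 M_F}Q_{M_F}^{W_F}(t)\otimes t^{\mathrm{rk} M^F}H_{M^F}^{W_F}(t^{-1})\Big).$$ The Boolean matroid $B_n$ is the matroid of rank $n$ on $n$ elements in which every subset is independent, with $S_n$ permuting the ground set. $V_{(1^n)}$ is the irreducible representation of $S_n$ indexed by the partition $(1,1,\ldots,1)$ of $n$. *)

(* Defs.v *)
From HB Require Import structures.
From mathcomp Require Import all_boot all_order all_algebra all_fingroup.
From mathcomp Require Import all_solvable all_field all_character.
From mathcomp Require Import ring.

Set Implicit Arguments.
Unset Strict Implicit.
Unset Printing Implicit Defensive.

Import Order.TTheory GRing.Theory Num.Theory.
Local Open Scope ring_scope.

(* A matroid has a ground set inside an ambient finite type T, so that          *)
(* localizations and contractions stay over the same T.                         *)
Record matroid (T : finType) := Matroid {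
  ground : {set T};
  indep : {set {set T}};
  indep_ground : forall I : {set T}, I \in indep -> I \subset ground;
  indep0 : set0 \in indep;
  indepW : forall I J : {set T}, J \in indep -> I \subset J -> I \in indep;
  indep_aug : forall I J : {set T}, I \in indep -> J \in indep -> (#|I| < #|J|)%N ->
    exists2 x, x \in J :\: I & x |: I \in indep }.

Section Matroid.
Variables (T : finType) (M : matroid T).
Implicit Types (F I J X Y : {set T}).

Definition rank X : nat := \max_(I in indep M | I \subset X) #|I|.

Definition rk : nat := rank (ground M).

Definition flats : {set {set T}} :=
  [set F : {set T} | (F \subset ground M) &&
     [forall x in ground M :\: F, rank F < rank (x |: F)]%N].

Definition circuits : {set {set T}} :=
  [set C : {set T} | [&& C \subset ground M, C \notin indep M &
     [forall x in C, C :\ x \in indep M]]].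

Lemma rank_indep I X : I \in indep M -> I \subset X -> (#|I| <= rank X)%N.
Proof.
by move=> iI sIX; rewrite (@leq_bigmax_cond _ _ _ I) // iI sIX.
Qed.

Lemma rank_basis X :
  exists B, [/\ B \in indep M, B \subset X & #|B| = rank X].
Proof.
have h0 : (0 < #|[pred I in indep M | I \subset X]|)%N.
  by apply/card_gt0P; exists set0; rewrite inE indep0 sub0set.
have [B /andP[iB sB] eB] := eq_bigmax_cond (fun I : {set T} => #|I|) h0.
by exists B; split=> //; rewrite /rank eB.
Qed.

Lemma rankS X Y : X \subset Y -> (rank X <= rank Y)%N.
Proof.
move=> sXY; have [B [iB sB <-]] := rank_basis X.
exact: rank_indep iB (subset_trans sB sXY).
Qed.

Lemma indep_extend I X : I \in indep M -> I \subset X ->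
  exists B, [/\ B \in indep M, I \subset B, B \subset X & #|B| = rank X].
Proof.
move=> iI sIX.
have [k] := ubnP (rank X - #|I|)%N.
elim: k I iI sIX => // k IHk I iI sIX lt_k.
have := rank_indep iI sIX; rewrite leq_eqVlt => /orP[/eqP eI | ltI].
  by exists I.
have [B [iB sB eB]] := rank_basis X; rewrite -eB in ltI lt_k.
have [x /setDP[xB xI] ixI] := indep_aug iI iB ltI.
have [] := IHk (x |: I) ixI.
- by rewrite subUset sub1set (subsetP sB).
- by rewrite cardsU1 xI -eB; apply: leq_trans (ltn_sub2l ltI (ltnSn _)) lt_k.
move=> B' [iB' sB' sB'X eB']; exists B'; split=> //.
by apply: subset_trans sB'; apply: subsetUr.
Qed.

Section Localization.
Variable F : {set T}.

Let lindep : {set {set T}} := [set I in indep M | I \subset F].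

Fact loc_ground I : I \in lindep -> I \subset ground M :&: F.
Proof. by rewrite inE subsetI => /andP[/indep_ground-> ->]. Qed.

Fact loc_indep0 : set0 \in lindep.
Proof. by rewrite inE indep0 sub0set. Qed.

Fact loc_indepW I J : J \in lindep -> I \subset J -> I \in lindep.
Proof.
rewrite !inE => /andP[iJ sJF] sIJ.
by rewrite (indepW iJ sIJ) (subset_trans sIJ).
Qed.

Fact loc_aug I J : I \in lindep -> J \in lindep -> (#|I| < #|J|)%N ->
  exists2 x, x \in J :\: I & x |: I \in lindep.
Proof.
rewrite !inE => /andP[iI sI] /andP[iJ sJ] ltIJ.
have [x xJI ix] := indep_aug iI iJ ltIJ; exists x; rewrite // inE ix.
by rewrite subUset sub1set sI (subsetP sJ) //; case/setDP: xJI.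
Qed.

Definition localization := Matroid loc_ground loc_indep0 loc_indepW loc_aug.

End Localization.

Section Contraction.
Variable F : {set T}.

Let cindep : {set {set T}} :=
  [set I : {set T} | (I \subset ground M :\: F) &&
     [exists B in indep M,
       [&& B \subset F, #|B| == rank F & I :|: B \in indep M]]].

Fact con_ground I : I \in cindep -> I \subset ground M :\: F.
Proof. by rewrite inE => /andP[]. Qed.

Fact con_indep0 : set0 \in cindep.
Proof.
rewrite inE sub0set; have [B [iB sB eB]] := rank_basis F.
by apply/existsP; exists B; rewrite iB sB eB eqxx set0U iB.
Qed.

Fact con_indepW I J : J \in cindep -> I \subset J -> I \in cindep.
Proof.
rewrite !inE => /andP[sJ /existsP[B /and4P[iB sB eB iJB]]] sIJ.
rewrite (subset_trans sIJ) //=; apply/existsP; exists B.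
by rewrite iB sB eB (indepW iJB) // setSU.
Qed.

Fact con_aug I J : I \in cindep -> J \in cindep -> (#|I| < #|J|)%N ->
  exists2 x, x \in J :\: I & x |: I \in cindep.
Proof.
rewrite !inE => /andP[sI /existsP[B /and4P[iB sB /eqP eB iIB]]].
case/andP=> sJ /existsP[B' /and4P[iB' sB' /eqP eB' iJB']] ltIJ.
have cU (K A : {set T}) : K \subset ground M :\: F -> A \subset F ->
    #|K :|: A| = (#|K| + #|A|)%N.
  move=> sK sA; rewrite cardsU (_ : K :&: A = set0) ?cards0 ?subn0 //.
  apply/setP=> z; rewrite !inE; apply/negP=> /andP[/(subsetP sK)].
  by rewrite inE => /andP[/negP nF _] /(subsetP sA).
have lt2 : (#|I :|: B| < #|J :|: B'|)%N by rewrite !cU // eB eB' ltn_add2r.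
have [x] := indep_aug iIB iJB' lt2; rewrite !inE negb_or.
case/andP=> /andP[xI xB] xJB' ix.
have xF : x \notin F.
  apply/negP=> xF; have: (#|x |: B| <= rank F)%N.
    apply: rank_indep; last by rewrite subUset sub1set xF.
    by apply: indepW ix _; rewrite setUCA subsetUr.
  by rewrite cardsU1 xB eB ltnn.
have xJ : x \in J.
  by case/orP: xJB' => // /(subsetP sB'); rewrite (negPf xF).
exists x; first by rewrite inE xI.
rewrite inE subUset sub1set (subsetP sJ) // sI /=; apply/existsP; exists B.
by rewrite iB sB eB eqxx -setUA.
Qed.

Definition contraction := Matroid con_ground con_indep0 con_indepW con_aug.

End Contraction.

End Matroid.

Section LatticesOfFlats.
Variables (T : finType) (M : matroid T).
Implicit Types (F G X Y : {set T}).

Lemma rank_localization F X :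
  X \subset F -> rank (localization M F) X = rank M X.
Proof.
move=> sXF; apply: eq_bigl => I; rewrite inE -andbA.
case: (I \in indep M) => //=; case sIX: (I \subset X); rewrite ?andbF // andbT.
exact: subset_trans sIX sXF.
Qed.

Lemma rank_contraction F X : X \subset ground M :\: F ->
  (rank (contraction M F) X + rank M F)%N = rank M (X :|: F).
Proof.
move=> sX; apply/eqP; rewrite eqn_leq; apply/andP; split.
  have [I [iI sI <-]] := rank_basis (contraction M F) X.
  move: iI; rewrite inE => /andP[sIE /existsP[B /and4P[iB sB /eqP <- iIB]]].
  rewrite -(_ : #|I :|: B| = #|I| + #|B|)%N.
    by rewrite rank_indep // setUSS.
  rewrite cardsU (_ : I :&: B = set0) ?cards0 ?subn0 //.
  apply/setP=> z; rewrite !inE; apply/negP=> /andP[/(subsetP sIE)].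
  by rewrite inE => /andP[/negP nF _] /(subsetP sB).
have [B [iB sB eB]] := rank_basis M F.
have [|A [iA sBA sA <-]] := @indep_extend _ M B (X :|: F) iB.
  exact: subset_trans sB (subsetUr _ _).
have eAF : A :&: F = B.
  apply/eqP; rewrite eq_sym eqEcard subsetI sBA sB eB.
  by apply: rank_indep (subsetIr _ _); apply: indepW iA (subsetIl _ _).
rewrite -(cardsID F A) eAF eB addnC leq_add2r; apply: rank_indep.
  rewrite inE (subset_trans _ sX) /=; last first.
    by rewrite subDset setUC.
  apply/existsP; exists B; rewrite iB sB eB eqxx -eAF setUC setID.
  exact: iA.
by rewrite subDset setUC.
Qed.

Lemma flats_localization F :
  F \in flats M -> flats (localization M F) = [set G in flats M | G \subset F].
Proof.
rewrite inE => /andP[sF /forall_inP fF]; apply/setP=> G; rewrite !inE /=.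
rewrite (setIidPr sF) [RHS]andbC.
case sGF: (G \subset F) => //=; rewrite (subset_trans sGF sF) /=.
apply/forall_inP/forall_inP=> fG x /setDP[xF xG]; last first.
  rewrite !rank_localization ?subUset ?sub1set ?xF //.
  by apply: fG; rewrite inE xG (subsetP sF).
have [{}xF | nxF] := boolP (x \in F).
  have := fG x; rewrite !rank_localization ?subUset ?sub1set ?xF //.
  by rewrite inE xG xF; apply.
have [B [iB sB eB]] := rank_basis M G.
have [A [iA sBA sA eA]] := indep_extend iB (subset_trans sB sGF).
have := fF x; rewrite inE nxF xF => /(_ isT) ltF.
have [C [iC sC eC]] := rank_basis M (x |: F).
have ltAC : (#|A| < #|C|)%N by rewrite eA eC.
have [y /setDP[yC yA] iy] := indep_aug iA iC ltAC.
have := subsetP sC y yC; rewrite !inE => /orP[/eqP ey | yF]; last first.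
  have: (#|y |: A| <= rank M F)%N by rewrite rank_indep // subUset sub1set yF.
  by rewrite cardsU1 yA eA ltnn.
rewrite {y yC yA}ey in iy.
have xB : x \notin B by apply: contra nxF => /(subsetP sB)/(subsetP sGF).
rewrite -eB -add1n -[1%N]/(true : nat) -xB -cardsU1 rank_indep ?setUS //.
by apply: indepW iy _; rewrite setUS.
Qed.

Lemma flats_contraction F : F \in flats M ->
  flats (contraction M F) = [set G :\: F | G in flats M & F \subset G].
Proof.
rewrite inE => /andP[sF _].
have key G : G \subset ground M :\: F ->
    (G \in flats (contraction M F)) = (G :|: F \in flats M).
  move=> sG; have sGE := subset_trans sG (subsetDl _ _).
  rewrite !inE /= sG subUset sGE sF /= setDDl [F :|: G]setUC.
  apply: eq_forallb_in => x; rewrite !inE negb_or => /andP[/andP[xG xF] xE].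
  rewrite setUA -!rank_contraction ?ltn_add2r //.
  by rewrite subUset sub1set sG !inE xF xE.
apply/setP=> G; apply/idP/imsetP => [fG | [H]].
  have sG : G \subset ground M :\: F by move: fG; rewrite inE => /andP[].
  exists (G :|: F); first by rewrite inE -key // fG subsetUr.
  rewrite setDUl setDv setU0; apply/esym/setDidPl.
  by rewrite disjoints_subset (subset_trans sG) // setDE subsetIr.
rewrite inE => /andP[fH sFH] ->.
have sH : H \subset ground M by move: fH; rewrite inE => /andP[].
by rewrite key ?setSD // setUC setDE setUIr setUCr setIT (setUidPr sFH).
Qed.

End LatticesOfFlats.

(* An equivariant matroid: a matroid on ground set E contained in T, and a      *)
(* group G acting on T by to, such that E and the matroid are G-stable.         *)
(* Every action of G on E is of this form, with G fixing T outside E.           *)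
Record eqmatroid (gT : finGroupType) (G D : {group gT}) (T : finType)
    (to : action D T) := EqMatroid {
  eqmat :> matroid T;
  acts_ground : [acts G, on ground eqmat | to];
  acts_indep : [acts G, on indep eqmat | to^*] }.

Section Equivariant.
Variables (gT : finGroupType) (G D : {group gT}) (T : finType).
Variables (to : action D T) (M : eqmatroid G to).
Implicit Types (F I X Y : {set T}).

Lemma eqm_dom : G \subset D.
Proof. by have /subsetIP[] := acts_ground M. Qed.

Lemma mem_ground_act g x : g \in G -> (to x g \in ground M) = (x \in ground M).
Proof. by move=> Gg; rewrite (acts_act (acts_ground M)). Qed.

Lemma mem_indep_act g I :
  g \in G -> (setact to I g \in indep M) = (I \in indep M).
Proof. by move=> Gg; have := acts_act (acts_indep M) Gg I. Qed.


Lemma sub_setact g X Y : (setact to X g \subset setact to Y g) = (X \subset Y).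
Proof.
apply/subsetP/subsetP=> sXY x.
  move=> xX; have /imsetP[y yY /act_inj->//] := sXY _ (imset_f (to^~ g) xX).
by case/imsetP=> y yX ->; apply: imset_f (sXY y yX).
Qed.

Lemma card_setact g X : #|setact to X g| = #|X|.
Proof. by rewrite card_imset //; apply: act_inj. Qed.

Fact stab_act F g : g \in 'N_G(F | to)%g ->
  (g \in G) * (setact to F g = F).
Proof.
case/setIP=> Gg Ng; split=> //; apply/eqP.
rewrite eqEcard card_setact leqnn andbT.
by apply/subsetP=> _ /imsetP[x xF ->]; rewrite (astabs_act _ Ng).
Qed.

Fact acts_ofP (H : {group gT}) (rT : finType) (ro : action D rT)
    (S : {set rT}) : H \subset G ->
  (forall g, g \in H -> forall x, x \in S -> ro x g \in S) ->
  [acts H, on S | ro].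
Proof.
move=> sHG HS; apply/subsetP=> g Hg.
rewrite inE (subsetP eqm_dom) ?(subsetP sHG) //= inE.
by apply/subsetP=> x xS; rewrite inE HS.
Qed.

Section EqLocalization.
Variable F : {set T}.

Fact loc_acts_ground : [acts 'N_G(F | to)%g, on ground (localization M F) | to].
Proof.
apply: acts_ofP (subsetIl _ _) _ => g Ng x /=; case/setIP=> xE xF.
have [Gg _] := stab_act Ng; case/setIP: (Ng) => _ N'g.
by rewrite inE mem_ground_act // xE (astabs_act _ N'g).
Qed.

Fact loc_acts_indep : [acts 'N_G(F | to)%g, on indep (localization M F) | to^*].
Proof.
apply: acts_ofP (subsetIl _ _) _ => g Ng I /=; rewrite !inE => /andP[iI sI].
have [Gg eF] := stab_act Ng.
by have := sub_setact g I F; rewrite mem_indep_act // iI eF sI.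
Qed.

Definition eqlocalization : eqmatroid 'N_G(F | to)%g to :=
  EqMatroid loc_acts_ground loc_acts_indep.

Fact con_acts_ground : [acts 'N_G(F | to)%g, on ground (contraction M F) | to].
Proof.
apply: acts_ofP (subsetIl _ _) _ => g Ng x /=; case/setDP=> xE xF.
have [Gg _] := stab_act Ng; case/setIP: (Ng) => _ N'g.
by rewrite inE mem_ground_act // xE (astabs_act _ N'g) xF.
Qed.

Fact con_acts_indep : [acts 'N_G(F | to)%g, on indep (contraction M F) | to^*].
Proof.
apply: acts_ofP (subsetIl _ _) _ => g Ng I; have [Gg eF] := stab_act Ng.
rewrite !inE => /andP[sI /existsP[B /and4P[iB sB eB iIB]]]; apply/andP; split.
  apply/subsetP=> _ /imsetP[x /(subsetP sI) xI ->].
  by have := acts_act con_acts_ground Ng x => /= ->.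
apply/existsP; exists (setact to B g).
rewrite mem_indep_act // iB card_setact eB.
have := sub_setact g B F; rewrite eF sB => -> /=.
by rewrite -imsetU mem_indep_act.
Qed.

Definition eqcontraction : eqmatroid 'N_G(F | to)%g to :=
  EqMatroid con_acts_ground con_acts_indep.

End EqLocalization.

End Equivariant.

(* The Orlik-Solomon algebra: the exterior algebra on the ground set modulo the *)
(* ideal generated by the boundaries of the circuits.                           *)

Section Sign.
Variable T : finType.

(* Number of inversions of s for the enumeration order of T.                    *)
Fixpoint inversions (s : seq T) : nat :=
  if s is x :: s' then
    (count (fun y => enum_rank y < enum_rank x)%N s' + inversions s')%N
  else 0%N.

Definition sort_sign (s : seq T) : algC := (-1) ^+ inversions s.

Let phi (f : T -> T) x y : algC :=
  (-1) ^+ (enum_rank y < enum_rank x)%N *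
  (-1) ^+ (enum_rank (f y) < enum_rank (f x))%N.

Lemma sort_sign_map_cons f x s :
  sort_sign (x :: s) * sort_sign (map f (x :: s)) =
  (\prod_(y <- s) phi f x y) * (sort_sign s * sort_sign (map f s)).
Proof.
rewrite /sort_sign /= !exprD mulrACA; congr (_ * _).
elim: s => [|y s IHs] /=; first by rewrite big_nil mulr1.
by rewrite big_cons !exprD -IHs mulrACA.
Qed.

Lemma phiC f x y : injective f -> x != y -> phi f x y = phi f y x.
Proof.
move=> injf neq_xy; have swap (u v : T) : u != v ->
    (-1) ^+ (enum_rank v < enum_rank u)%N
    = - (-1) ^+ (enum_rank u < enum_rank v)%N :> algC.
  move=> neq_uv; have [||/val_inj/enum_rank_inj/eqP] := ltngtP (enum_rank u) (enum_rank v).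
  - by rewrite expr0 expr1 opprK.
  - by rewrite expr0 expr1.
  by rewrite (negPf neq_uv).
by rewrite /phi swap // (swap (f x)) ?(inj_eq injf) // mulrNN.
Qed.

Lemma sort_sign_perm f s t : injective f -> uniq s -> perm_eq s t ->
  sort_sign s * sort_sign (map f s) = sort_sign t * sort_sign (map f t).
Proof.
move=> injf; elim: s t => [|x s IHs] t; first by move=> _; rewrite perm_sym => /perm_nilP->.
move=> /= /andP[xs us] eqst.
have xt : x \in t by rewrite -(perm_mem eqst) mem_head.
case/splitPr: t / xt eqst => t1 t2; rewrite perm_sym -cat1s perm_catCA perm_sym.
rewrite /= perm_cons => eqst.
rewrite sort_sign_map_cons (IHs _ us eqst) (perm_big _ eqst) /=.
have: x \notin t1 by apply: contra xs; rewrite (perm_mem eqst) mem_cat => ->.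
elim: t1 {eqst} => [|y t1 IHt]; first by rewrite -sort_sign_map_cons.
rewrite inE negb_or => /andP[neq_xy /IHt IH]; rewrite !cat_cons.
rewrite !sort_sign_map_cons -{}IH big_cons !big_cat /= big_cons.
by rewrite (phiC _ neq_xy) //; ring.
Qed.

Lemma sort_sign_sqr s : sort_sign s * sort_sign s = 1.
Proof. by rewrite /sort_sign -expr2 sqrr_sign. Qed.

Lemma inversions_enum (S : {set T}) : inversions (enum S) = 0%N.
Proof.
have : pairwise (fun x y => enum_rank x < enum_rank y)%N (enum S).
  rewrite {1}/enum_mem -enumT; apply: pairwise_filter.
  case: (pickP T) => [x0 _ | T0]; last first.
    by case: (enum T) => // x; have := T0 x.
  apply/(pairwiseP x0) => i j; rewrite !inE -!cardE => lti ltj ltij.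
  rewrite -[i]/(nat_of_ord (Ordinal lti)) -[j]/(nat_of_ord (Ordinal ltj)).
  by rewrite -!(enum_val_nth x0 (Ordinal _)) !enum_valK.
elim: (enum S) => //= x s IHs /andP[/allP lt_x /IHs->]; rewrite addn0.
apply/eqP; rewrite -leqn0 leqNgt -has_count; apply/hasPn=> y /lt_x ltxy.
by rewrite -leqNgt ltnW.
Qed.

End Sign.

Section OrlikSolomon.
Variables (gT : finGroupType) (G D : {group gT}) (T : finType).
Variables (to : action D T) (M : eqmatroid G to) (i : nat).

(* Index set of the standard basis of the i-th exterior power.                  *)
Definition ext_index : {set {set T}} :=
  [set S : {set T} | (S \subset ground M) && (#|S| == i)].

(* e_{s_1} /\ ... /\ e_{s_k}; this is 0 if s has repetitions, and also if s is  *)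
(* not a list of i elements of the ground set.                                  *)
Definition wedge (s : seq T) : 'rV[algC]_#|ext_index| :=
  \row_j (sort_sign s *+ (uniq s && ([set x in s] == enum_val j))).

Definition ext_mx (g : gT) : 'M[algC]_#|ext_index| :=
  \matrix_(j < #|ext_index|)
    wedge [seq to x g | x <- enum (enum_val j : {set T})].

Lemma wedge_enum (j : 'I_#|ext_index|) :
  wedge (enum (enum_val j : {set T})) = delta_mx 0 j.
Proof.
apply/rowP=> k; rewrite !mxE /sort_sign inversions_enum expr0 enum_uniq /=.
by rewrite set_enum (inj_eq enum_val_inj) eq_sym.
Qed.

Lemma wedge_act s g : g \in G ->
  wedge s *m ext_mx g = wedge [seq to x g | x <- s].
Proof.
move=> Gg; apply/rowP=> k; rewrite !mxE (map_inj_uniq (act_inj to g)).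
have [us | /negPf us] := boolP (uniq s); last first.
  by rewrite big1 // => j _; rewrite !mxE us mul0r.
have im (t : seq T) : [set x in [seq to x g | x <- t]]
    = setact to [set x in t] g.
  apply/setP=> y; rewrite inE; apply/mapP/imsetP=> -[x xt ->]; exists x => //.
    by rewrite inE.
  by rewrite inE in xt.
have [sI | sNI] := boolP ([set x in s] \in ext_index).
  pose j0 := enum_rank_in sI [set x in s].
  have ej0 : enum_val j0 = [set x in s] by rewrite enum_rankK_in.
  rewrite (bigD1 j0) //= big1 ?addr0 => [|j neq_j]; last first.
    rewrite !mxE -ej0 (inj_eq enum_val_inj) eq_sym (negPf neq_j) andbF.
    by rewrite mulr0n mul0r.
  rewrite !mxE ej0 us eqxx mulr1n (map_inj_uniq (act_inj to g)) enum_uniq /=.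
  rewrite !im set_enum mulrnAr; congr (_ *+ _).
  have eqs : perm_eq s (enum [set x in s]).
    by rewrite uniq_perm ?enum_uniq // => x; rewrite mem_enum inE.
  have := sort_sign_perm (act_inj to g) us eqs.
  rewrite [X in _ = X * _]/sort_sign inversions_enum expr0 mul1r => <-.
  by rewrite mulrA sort_sign_sqr mul1r.
rewrite big1 => [|j _]; last first.
  rewrite !mxE; case: eqP => [es | _]; last by rewrite andbF mulr0n mul0r.
  by rewrite es enum_valP in sNI.
rewrite im; case: eqP => [es|]; last by rewrite andbF.
have := enum_valP k; rewrite -es inE card_setact; case/andP=> sE cS.
case/negP: sNI; rewrite inE cS andbT; apply/subsetP=> x xs.
by rewrite -(mem_ground_act M x Gg); apply/(subsetP sE)/imset_f.
Qed.

Fact ext_mx_repr : mx_repr G ext_mx.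
Proof.
split=> [|g h Gg Gh].
  apply/row_matrixP=> j; rewrite rowK row1 -wedge_enum; congr wedge.
  by rewrite (eq_map (act1 to)) map_id.
apply/row_matrixP=> j; rewrite row_mul !rowK wedge_act // -map_comp.
congr wedge; apply: eq_map => x /=.
by rewrite actMin // (subsetP (eqm_dom M)).
Qed.

Definition ext_repr := MxRepresentation ext_mx_repr.

(* e_u /\ d(e_c), with d(e_c) = \sum_j (-1)^j e_{c without its j-th entry}.     *)
Definition os_relation (u c : seq T) : 'rV[algC]_#|ext_index| :=
  \sum_(j < size c) (-1) ^+ j *: wedge (u ++ take j c ++ drop j.+1 c).

(* Degree i part of the ideal: u and c run over all lists of lengths k and      *)
(* i - k + 1 such that the entries of c are distinct and form a circuit.        *)
Definition os_ideal : 'M[algC]_#|ext_index| :=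
  (\sum_(k < i.+1) \sum_(u : k.-tuple T)
     \sum_(c : (i - k).+1.-tuple T | uniq c && ([set x in c] \in circuits M))
        <<os_relation u c>>)%MS.

Lemma os_relation_act u c g : g \in G ->
  os_relation u c *m ext_mx g
  = os_relation [seq to x g | x <- u] [seq to x g | x <- c].
Proof.
move=> Gg; rewrite /os_relation size_map mulmx_suml; apply: eq_bigr => j _.
by rewrite -scalemxAl wedge_act // !map_cat map_take map_drop.
Qed.

Lemma circuits_act g (C : {set T}) : g \in G ->
  C \in circuits M -> setact to C g \in circuits M.
Proof.
move=> Gg; rewrite !inE mem_indep_act // => /and3P[sC -> /forall_inP mC] /=.
apply/andP; split.
  by apply/subsetP=> _ /imsetP[x /(subsetP sC) xE ->]; rewrite mem_ground_act.
apply/forall_inP=> _ /imsetP[x xC ->].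
rewrite (_ : _ :\ _ = setact to (C :\ x) g) ?mem_indep_act ?mC //.
apply/setP=> y; rewrite 2!inE.
apply/andP/imsetP=> [[neq /imsetP[z zC ez]] | [z /setD1P[neq zC] ->]].
  by exists z; rewrite // !inE zC andbT; apply: contraNneq neq => <-; rewrite ez.
by rewrite (inj_eq (act_inj to g)) neq; split=> //; apply: imset_f.
Qed.

Fact os_ideal_module : mxmodule ext_repr os_ideal.
Proof.
apply/mxmoduleP=> g Gg /=; rewrite /os_ideal sumsmxMr.
apply/sumsmx_subP=> k _; apply: (sumsmx_sup k) => //; rewrite sumsmxMr.
apply/sumsmx_subP=> u _; apply: (sumsmx_sup [tuple of map (to^~ g) u]) => //.
rewrite sumsmxMr; apply/sumsmx_subP=> c /andP[uc Cc].
apply: (sumsmx_sup [tuple of map (to^~ g) c]) => /=.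
  rewrite (map_inj_uniq (act_inj to g)) uc /=.
  have -> : [set x in map (to^~ g) c] = setact to [set x in c] g.
    apply/setP=> y; rewrite inE; apply/mapP/imsetP=> -[x xt ->]; exists x => //.
      by rewrite inE.
    by rewrite inE in xt.
  exact: circuits_act.
by rewrite (eqmxMr _ (genmxE _)) genmxE os_relation_act.
Qed.

Definition os_char : 'CF(G) := cfRepr (factmod_repr os_ideal_module).

End OrlikSolomon.

Section Polynomials.
Variables (gT : finGroupType) (G D : {group gT}) (T : finType).
Variables (to : action D T) (M : eqmatroid G to).

Definition eq_char_poly : {poly 'CF(G)} :=
  \sum_(i < (rk M).+1) ((-1) ^+ i * os_char M i) *: 'X^(rk M - i).

End Polynomials.

(* t^n p(t^-1), for a polynomial p of degree at most n.                         *)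
Definition reversal (R : nzRingType) (n : nat) (p : {poly R}) : {poly R} :=
  \poly_(i < n.+1) p`_(n - i).

(* VRep(G) is identified with the ring 'Z[irr G] of virtual characters in 'CF(G); *)
(* tensor products and induction are those of class functions.                  *)
Definition eq_assignment : Type :=
  forall (gT : finGroupType) (G D : {group gT}) (T : finType) (to : action D T),
    eqmatroid G to -> {poly 'CF(G)}.

Definition inverse_KL (Q : eq_assignment) : Prop :=
  forall (gT : finGroupType) (G D : {group gT}) (T : finType)
    (to : action D T) (M : eqmatroid G to),
  [/\ Q _ _ _ _ _ M \is a polyOver 'Z[irr G]%g,
      rk M = 0%N -> Q _ _ _ _ _ M = 1,
      (0 < rk M)%N -> (2 * (size (Q _ _ _ _ _ M)).-1 < rk M)%N &
      (-1) ^+ rk M * reversal (rk M) (Q _ _ _ _ _ M) =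
      \sum_(F in orbit_transversal to^*%act G (flats M))
        map_poly 'Ind[G, 'N_G(F | to)]%g
          ((-1) ^+ rk (localization M F) * Q _ _ _ _ _ (eqlocalization M F) *
           reversal (rk (contraction M F)) (eq_char_poly (eqcontraction M F)))].

Section Boolean.
Variable n : nat.

Let bindep : {set {set 'I_n}} := setT.

Fact bool_ground (I : {set 'I_n}) : I \in bindep -> I \subset [set: 'I_n].
Proof. by rewrite subsetT. Qed.

Fact bool_indep0 : set0 \in bindep.
Proof. exact: in_setT. Qed.

Fact bool_indepW (I J : {set 'I_n}) : J \in bindep -> I \subset J -> I \in bindep.
Proof. by move=> _ _; apply: in_setT. Qed.

Fact bool_aug (I J : {set 'I_n}) : I \in bindep -> J \in bindep ->
  (#|I| < #|J|)%N -> exists2 x, x \in J :\: I & x |: I \in bindep.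
Proof.
move=> _ _ ltIJ; have /subsetPn[x xJ xI] : ~~ (J \subset I).
  by apply: contraL ltIJ => /subset_leq_card; rewrite -leqNgt.
by exists x; [rewrite inE xI | apply: in_setT].
Qed.

Definition boolean_matroid : matroid 'I_n :=
  Matroid bool_ground bool_indep0 bool_indepW bool_aug.

Fact bool_acts_ground :
  [acts [set: 'S_n], on ground boolean_matroid | 'P%act].
Proof. by apply/subsetP=> g _; rewrite !inE; apply/subsetP=> x; rewrite !inE. Qed.

Fact bool_acts_indep :
  [acts [set: 'S_n], on indep boolean_matroid | ('P^*)%act].
Proof. by apply/subsetP=> g _; rewrite !inE; apply/subsetP=> x; rewrite !inE. Qed.

Definition eqboolean : @eqmatroid _ [set: 'S_n]%G _ _ 'P%act :=
  EqMatroid bool_acts_ground bool_acts_indep.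

Fact sign_mx_repr :
  mx_repr [set: 'S_n] (fun s : 'S_n => ((-1) ^+ s)%:M : 'M[algC]_1).
Proof.
split=> [|s t _ _]; first by rewrite odd_perm1.
by rewrite odd_permM signr_addb scalar_mxM.
Qed.

(* V_{(1^n)}, the sign representation.                                          *)
Definition sign_char : 'CF([set: 'S_n]) := cfRepr (MxRepresentation sign_mx_repr).

End Boolean.

(* Main.v *)
(* In rank r > 0, the coefficients of degree > r/2 of the recursion (c) involve *)
(* only proper flats: the term of the full flat has degree < r/2, while         *)
(* t^r Q(t^-1) has no other coefficients.  So (c) determines Q_M from smaller   *)
(* matroids.  If every subset of the ground set E is independent then, by       *)
(* induction, for j > r/2 the coefficient of t^j of the right-hand side is, at  *)
(* g,                                                                           *)
(*   \sum_F \sum_S (-1)^(|F| + j) sgn(g|F) sgn(g|S),                            *)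
(* over disjoint g-stable F, S with |S| = j.  For a fixed S the sum over F      *)
(* vanishes unless S = E, because toggling a g-orbit of length m in F changes   *)
(* (-1)^|F| sgn(g|F) by (-1)^m (-1)^(m - 1) = -1.                               *)
Require Import Defs.
From mathcomp Require Import all_boot all_order all_algebra all_fingroup.
From mathcomp Require Import all_solvable all_field all_character.
From mathcomp Require Import ring.

Set Implicit Arguments.
Unset Strict Implicit.
Unset Printing Implicit Defensive.

Import Order.TTheory GRing.Theory Num.Theory.
Local Open Scope ring_scope.

(** The result is proved for every matroid whose ground set [E] is independent and every group
    acting on it ([inverse_KL_free]), because the recursion passes to localizations with stabilizer
    groups. The value at [g] of the coefficient of degree [k] is shown to be the sign of [g] on [E]
    if [k = 0], and 0 otherwise, by strong induction on the size of [E].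

    Three facts turn the recursion into the signed sum displayed above. There are no circuits, so
    the Orlik-Solomon algebra is the whole exterior algebra, and its character at [g] is a sum of
    signs over [g]-stable subsets ([os_char_free]). Summing induced class functions over orbit
    representatives of flats amounts to summing over the flats fixed by [g]
    ([sum_cfInd_orbit_transversal]). Finally, the orbit-toggling involution ([sum_relsign])
    collapses the double sum over [F] and [S] ([sum_relsign_ext_trace]). *)

(** * Signs of permutations restricted to stable subsets *)

Section RestrictedSign.
Variable T : finType.
Implicit Types (f : T -> T) (s t : seq T) (A B C F S : {set T}).

(* The sign of the permutation induced by f on A, for f injective and f @: A = A. *)
Definition relsign f A : algC := sort_sign [seq f x | x <- enum A].

Definition cross s t : nat :=
  (\sum_(x <- s) \sum_(y <- t) (enum_rank y < enum_rank x))%N.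

Lemma perm_cross s s' t t' :
  perm_eq s s' -> perm_eq t t' -> cross s t = cross s' t'.
Proof.
move=> ps pt; rewrite /cross (perm_big _ ps) /=.
by apply: eq_bigr => x _; rewrite (perm_big _ pt).
Qed.

Lemma sort_sign_cat s t :
  sort_sign (s ++ t) = (-1) ^+ cross s t * (sort_sign s * sort_sign t).
Proof.
rewrite /sort_sign -!exprD; congr (_ ^+ _); elim: s => [|x s IHs] /=.
  by rewrite /cross big_nil.
have -> : cross (x :: s) t
    = (count (fun y => enum_rank y < enum_rank x)%N t + cross s t)%N.
  by rewrite /cross big_cons -sum1_count [in RHS]big_mkcond.
by rewrite {}IHs count_cat; ring.
Qed.

(** Reordering [s] changes both factors by the same sign, so any convenient listing of [A] may
    replace its enumeration. *)
Lemma relsign_seq f s A : injective f -> uniq s -> s =i A ->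
  sort_sign s * sort_sign (map f s) = relsign f A.
Proof.
move=> injf us eqs; rewrite (@sort_sign_perm _ f s (enum A)) //; last first.
  by rewrite uniq_perm ?enum_uniq // => x; rewrite mem_enum eqs.
by rewrite [X in X * _]/sort_sign inversions_enum expr0 mul1r.
Qed.

Lemma relsign0 f : relsign f set0 = 1.
Proof. by rewrite /relsign enum_set0. Qed.

Lemma eq_in_relsign f f' A : {in A, f =1 f'} -> relsign f A = relsign f' A.
Proof.
move=> eqf; congr sort_sign; apply/eq_in_map => x; rewrite mem_enum.
exact: eqf.
Qed.

Lemma relsign_id A : relsign id A = 1.
Proof. by rewrite /relsign map_id /sort_sign inversions_enum. Qed.

Lemma mem_map_enum f A : map f (enum A) =i f @: A.
Proof.
move=> x; apply/mapP/imsetP => -[y yA ->]; exists y => //.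
  by rewrite -mem_enum.
by rewrite mem_enum.
Qed.

Lemma perm_map_enum f A :
  injective f -> f @: A = A -> perm_eq (map f (enum A)) (enum A).
Proof.
move=> injf fA; apply: uniq_perm; rewrite ?map_inj_uniq ?enum_uniq // => x.
by rewrite mem_map_enum fA mem_enum.
Qed.

(** The inversions between the two blocks depend only on the blocks as sets, which [f] preserves;
    they are counted twice and cancel. *)
Lemma relsignU f A B : injective f -> f @: A = A -> f @: B = B ->
  [disjoint A & B] -> relsign f (A :|: B) = relsign f A * relsign f B.
Proof.
move=> injf fA fB dAB; rewrite -(@relsign_seq f (enum A ++ enum B)) //.
- rewrite map_cat !sort_sign_cat mulrACA -exprD.
  rewrite (perm_cross (perm_map_enum injf fA) (perm_map_enum injf fB)).
  rewrite addnn -mul2n exprM sqrrN expr1n expr1n mul1r.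
  by rewrite /sort_sign !inversions_enum /= expr0 !mul1r.
- rewrite cat_uniq !enum_uniq andbT /=; apply/hasPn => x; rewrite !mem_enum.
  by apply: contraL => /(disjointFr dAB) ->.
by move=> x; rewrite mem_cat !mem_enum inE.
Qed.

Lemma relsign_fcycle f x p A : injective f -> fcycle f (x :: p) ->
  uniq (x :: p) -> x :: p =i A -> relsign f A = (-1) ^+ size p.
Proof.
move=> injf cp up eqA; rewrite -(relsign_seq injf up eqA).
have -> : map f (x :: p) = rcons p x.
  move: cp => /=; move: {2 4}x => z.
  elim: p {up eqA} x => [|y p IHp] x /=; first by rewrite andbT => /eqP->.
  by case/andP=> /eqP -> /IHp ->.
(* Applying [f] moves [x] from the front of [p] to its end. Each entry of [p] is inverted with [x]
   in exactly one of the two positions, hence the exponent [size p]. *)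
rewrite -cats1 -cat1s !sort_sign_cat mulrACA -exprD mulrACA [X in _ * (_ * X)]mulrC.
rewrite mulrACA !sort_sign_sqr !mulr1; congr (_ ^+ _).
have /= /andP[xp _] := up.
rewrite /cross big_seq1 -sum1_size.
under [X in (_ + X)%N]eq_bigr do rewrite big_seq1.
rewrite -big_split /= !big_seq; apply: eq_bigr => y yp.
case: ltngtP => // /val_inj/enum_rank_inj eyx.
by rewrite -eyx yp in xp.
Qed.

Lemma orbit_stable f F x : injective f -> f @: F = F -> x \in F ->
  [set y in fingraph.orbit f x] \subset F.
Proof.
move=> injf fF xF; apply/subsetP=> y; rewrite inE -fconnect_orbit.
case/connectP=> p; elim: p x xF => [|z p IHp] x xF /=; first by move=> _ ->.
by case/andP=> /eqP <- /IHp; apply; rewrite -fF imset_f.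
Qed.

Lemma imset_orbit f x : injective f ->
  f @: [set y in fingraph.orbit f x] = [set y in fingraph.orbit f x].
Proof.
move=> injf; apply/eqP; rewrite eqEcard card_imset // leqnn andbT.
apply/subsetP=> _ /imsetP[y + ->]; rewrite !inE -!fconnect_orbit => xy.
exact: connect_trans xy (fconnect1 _ _).
Qed.

Lemma relsign_orbit f x : injective f ->
  relsign f [set y in fingraph.orbit f x]
  = - (-1) ^+ #|[set y in fingraph.orbit f x]|.
Proof.
move=> injf; have uo := orbit_uniq f x; have co := cycle_orbit injf x.
rewrite cardsE (card_uniqP uo).
case def_o: (fingraph.orbit f x) uo co => [|y p] uo co.
  by have := in_orbit f x; rewrite def_o.
rewrite (relsign_fcycle injf co uo) /= => [|z]; last by rewrite inE.
by rewrite exprS mulN1r opprK.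
Qed.

(** If [A] contains some [x], toggling the whole orbit [C] of [x] is a sign-reversing involution on
    the stable subsets of [A]. *)
Lemma sum_relsign f A : injective f -> f @: A = A ->
  \sum_(F : {set T} | (F \subset A) && (f @: F == F)) (-1) ^+ #|F| * relsign f F
  = (A == set0)%:R.
Proof.
move=> injf fA; have [->|/set0Pn[x xA]] := eqVneq A set0.
  rewrite (big_pred1 set0) ?cards0 ?relsign0 ?mulr1 // => F /=.
  by rewrite subset0; case: eqP => // ->; rewrite imset0 eqxx.
pose C := [set y in fingraph.orbit f x].
have xC : x \in C by rewrite inE in_orbit.
have fC : f @: C = C by apply: imset_orbit.
have sCA : C \subset A by apply: orbit_stable.
have fD F : f @: F = F -> f @: (F :\: C) = F :\: C.
  move=> fF; apply/eqP; rewrite eqEcard card_imset // leqnn andbT.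
  apply/subsetP=> _ /imsetP[y /setDP[yF yC] ->].
  by rewrite inE -fF -fC !mem_imset // yC yF.
have sC F : f @: F = F -> x \in F -> C \subset F by apply: orbit_stable.
rewrite (bigID (fun F : {set T} => x \in F)) /=.
(* A stable set containing [x] contains [C], so adding and removing [C] match the stable sets with
   and without [x]. *)
rewrite (reindex_onto (fun F => F :|: C) (fun F => F :\: C)) /=; last first.
  by move=> F /andP[/andP[_ /eqP fF] /(sC _ fF)]; rewrite setUC => /setIidPr eC;
     rewrite -{2}(setID F C) eC.
rewrite -[RHS](addNr (\sum_(F : {set T} | (F \subset A) && (f @: F == F)
                          && (x \notin F)) (-1) ^+ #|F| * relsign f F)).
congr (_ + _); rewrite -sumrN; apply: eq_big => [F | F].
  rewrite subUset sCA andbT [x \in _]inE xC orbT andbT.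
  apply/andP/andP=> [[/andP[sFA /eqP fFC] /eqP eF] | [/andP[sFA /eqP fF] xF]].
    by rewrite sFA -eF fD // [x \in _]inE xC eqxx.
  rewrite sFA imsetU fF fC eqxx setDUl setDv setU0; split=> //.
  rewrite (_ : F :\: C = F) //; apply/setDidPl; rewrite disjoints_subset.
  apply/subsetP=> y yF; rewrite !inE -fconnect_orbit fconnect_sym //.
  apply: contra xF => yx; have /subsetP := orbit_stable injf fF yF; apply.
  by rewrite inE -fconnect_orbit.
case/andP=> /andP[/andP[sFA /eqP fFC] _] /eqP eF.
have fF : f @: F = F by rewrite -eF fD.
have dFC : [disjoint F & C].
  by apply/setDidPl; rewrite -{2}eF setDUl setDv setU0.
rewrite relsignU // cardsU disjoint_setI0 // cards0 subn0 relsign_orbit //.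
rewrite exprD -/C; transitivity (- ((-1) ^+ #|F| * relsign f F) * ((-1) ^+ #|C| ^+ 2)).
  by ring.
by rewrite sqrr_sign mulr1.
Qed.

Lemma relsign_comp f h A : injective f -> injective h -> h @: A = A ->
  relsign (f \o h) A = relsign f A * relsign h A.
Proof.
move=> injf injh hA; rewrite -[in RHS](@relsign_seq f (map h (enum A))) //.
- by rewrite -map_comp mulrC mulrA sort_sign_sqr mul1r.
- by rewrite map_inj_uniq ?enum_uniq.
by move=> x; rewrite (perm_mem (perm_map_enum injh hA)) mem_enum.
Qed.

(** The set [h @: A] is listed as the image of the enumeration of [A]; the sign of [h] along that
    list then occurs twice and cancels. Here [h] may move [A], as [relsign_comp] asks only its inner
    map to preserve the set. *)
Lemma relsign_conj f f' h A : injective f -> injective h -> f @: A = A ->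
  f' \o h =1 h \o f -> injective f' -> relsign f' (h @: A) = relsign f A.
Proof.
move=> injf injh fA eqf injf'.
rewrite -(@relsign_seq f' (map h (enum A))) //; last first.
- exact: mem_map_enum.
- by rewrite map_inj_uniq ?enum_uniq.
rewrite -map_comp (eq_map eqf) -[sort_sign (map (h \o f) _)]/(relsign (h \o f) A).
by rewrite relsign_comp // mulrA sort_sign_sqr mul1r.
Qed.

(** Both sides are multiplicative, so it suffices to treat a transposition: a 2-cycle on a pair and
    the identity on its complement. *)
Lemma relsign_perm (p : {perm T}) : relsign p setT = (-1) ^+ p.
Proof.
have imT (q : {perm T}) : q @: setT = setT.
  by apply/setP=> z; rewrite inE -(permKV q z) mem_imset ?inE //; apply: perm_inj.
have [ts -> dts] := prod_tpermP p.
elim: ts dts => [|[x y] ts IHts] /= => [_ | /andP[neq_xy /IHts{}IHts]].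
  rewrite big_nil odd_perm1 expr0; apply: etrans (relsign_id setT).
  by apply: eq_in_relsign => z _; rewrite perm1.
rewrite big_cons odd_mul_tperm neq_xy signr_addb -{}IHts /=.
set q := (\prod_(_ <- _) _)%g.
rewrite (_ : relsign _ _ = relsign (q \o tperm x y) setT); last first.
  by apply: eq_in_relsign => z _; rewrite /= permM.
rewrite relsign_comp ?imT //; try exact: perm_inj; rewrite mulrC; congr (_ * _).
pose A := [set x; y].
have tA : tperm x y @: A = A.
  by rewrite imsetU !imset_set1 tpermL tpermR setUC.
have tCA : {in ~: A, tperm x y =1 id}.
  by move=> z; rewrite !inE negb_or => /andP[zx zy]; rewrite tpermD 1?eq_sym.
rewrite -(setUCr A) relsignU //; first last.
- by rewrite -setI_eq0 setICr.
- by rewrite (eq_in_imset tCA) imset_id.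
- exact: perm_inj.
rewrite (eq_in_relsign tCA) relsign_id mulr1.
rewrite (@relsign_fcycle _ x [:: y]) //=.
- exact: perm_inj.
- by rewrite tpermL tpermR !eqxx.
- by rewrite inE neq_xy.
by move=> z; rewrite !inE.
Qed.

End RestrictedSign.

(** * Matroids with independent ground set *)

Section FreeMatroid.
Variables (T : finType) (M : matroid T).
Hypothesis freeM : ground M \in indep M.
Implicit Types F X : {set T}.

Lemma rank_free X : X \subset ground M -> Defs.rank M X = #|X|.
Proof.
move=> sX; apply/eqP; rewrite eqn_leq andbC rank_indep ?(indepW freeM) //=.
by have [B [_ sB <-]] := rank_basis M X; apply: subset_leq_card.
Qed.

Lemma rk_free : rk M = #|ground M|.
Proof. exact: rank_free. Qed.

Lemma flats_free : flats M = powerset (ground M).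
Proof.
apply/setP=> F; rewrite !inE; case: (boolP (F \subset ground M)) => //= sF.
apply/forall_inP=> x /setDP[xE xF]; rewrite !rank_free ?subUset ?sub1set ?xE //.
by rewrite cardsU1 xF.
Qed.

Lemma circuits_free : circuits M = set0.
Proof.
apply/setP=> C; rewrite !inE; apply/negP=> /and3P[sC + _].
by rewrite (indepW freeM).
Qed.

Lemma free_localization F :
  ground (localization M F) \in indep (localization M F).
Proof. by rewrite inE subsetIr (indepW freeM) ?subsetIl. Qed.

Lemma free_contraction F : F \subset ground M ->
  ground (contraction M F) \in indep (contraction M F).
Proof.
move=> sF; rewrite inE subxx; apply/existsP; exists F.
by rewrite subxx rank_free // eqxx !(indepW freeM) // subUset subsetDl.
Qed.

End FreeMatroid.

(** * Traces on exterior powers and the cancellation of the double sum *)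

Section ExteriorTrace.
Variables (T : finType).
Implicit Types (f : T -> T) (A E F S : {set T}).

(** For [f] permuting [A], this is the trace of [f] on the [i]-th exterior power of the space with
    basis [A]: only stable subsets give diagonal entries. *)
Definition ext_trace f A i : algC :=
  \sum_(S : {set T} | [&& S \subset A, #|S| == i & f @: S == S]) relsign f S.

Lemma ext_trace_gt f A i : (#|A| < i)%N -> ext_trace f A i = 0.
Proof.
move=> ltAi; rewrite /ext_trace big_pred0 // => S; apply/and3P=> -[].
by move=> /subset_leq_card leSA /eqP eS _; rewrite leqNgt eS ltAi in leSA.
Qed.

Lemma ext_trace_conj f f' h A i : injective f -> injective f' -> injective h ->
  f' \o h =1 h \o f -> ext_trace f' (h @: A) i = ext_trace f A i.
Proof.
move=> injf injf' injh eqf; rewrite /ext_trace (reindex_inj (imset_inj injh)).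
have fhE S : f' @: (h @: S) = h @: (f @: S).
  by rewrite -!imset_comp; apply: eq_imset.
apply: eq_big => [S | S /and3P[_ _]]; rewrite fhE (inj_eq (imset_inj injh)).
  rewrite card_imset //; congr (_ && _); apply/subsetP/subsetP=> sSA x.
    by move=> xS; rewrite -(mem_imset _ _ injh) sSA ?imset_f.
  by case/imsetP=> y yS ->; rewrite imset_f ?sSA.
by move=> /eqP fS; apply: relsign_conj.
Qed.

Lemma sum_relsign_ext_trace f E j : injective f -> f @: E = E ->
  \sum_(F in powerset E | f @: F == F)
     (-1) ^+ #|F| * relsign f F * ((-1) ^+ j * ext_trace f (E :\: F) j)
  = (j == #|E|)%:R * ((-1) ^+ j * relsign f E).
Proof.
move=> injf fE.
under eq_bigr do rewrite /ext_trace 2!mulr_sumr.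
rewrite (exchange_big_dep
  (fun S : {set T} => [&& S \subset E, #|S| == j & f @: S == S])) /=; last first.
  by move=> F S _ /and3P[sS -> ->]; rewrite (subset_trans sS) ?subsetDl.
(* For fixed [S], the set [F] runs over the stable subsets of [E :\: S], and [sum_relsign] evaluates
   that inner sum. *)
transitivity (\sum_(S : {set T} | [&& S \subset E, #|S| == j & f @: S == S])
   (E :\: S == set0)%:R * ((-1) ^+ j * relsign f S)).
  apply: eq_bigr => S /and3P[sSE cS /eqP fS].
  rewrite -(@sum_relsign _ f) //; last first.
    apply/eqP; rewrite eqEcard card_imset // leqnn andbT.
    apply/subsetP=> _ /imsetP[y /setDP[yE yS] ->].
    by rewrite inE -fE -fS !mem_imset // yE yS.
  rewrite mulr_suml; apply: eq_big => [F | F _]; last by ring.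
  rewrite inE cS fS eqxx !andbT !subsetD sSE /= disjoint_sym.
  by rewrite andbAC.
have [-> | neq_j] := eqVneq j #|E|; last first.
  rewrite mul0r big1 // => S /and3P[sSE /eqP cS _].
  rewrite setD_eq0; case: (boolP (E \subset S)) => [sES | _]; last by rewrite mul0r.
  by case/eqP: neq_j; rewrite -cS; apply/eqP; rewrite eqn_leq !subset_leq_card.
rewrite (big_pred1 E) => [|S]; first by rewrite setDv eqxx.
apply/and3P/eqP=> [[sSE /eqP cS _] | ->]; last by rewrite subxx fE !eqxx.
by apply/eqP; rewrite eqEcard sSE cS leqnn.
Qed.

End ExteriorTrace.

Lemma cfun_signM (gT : finGroupType) (G : {group gT}) (phi : 'CF(G)) n g :
  ((-1) ^+ n * phi) g = (-1) ^+ n * phi g.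
Proof.
rewrite -signr_odd -[in RHS]signr_odd.
by case: (odd n); rewrite ?expr0 ?mul1r ?expr1 ?mulN1r ?cfunE.
Qed.

Lemma coef_signM (R : nzRingType) (p : {poly R}) n i :
  ((-1) ^+ n * p)`_i = (-1) ^+ n * p`_i.
Proof.
rewrite -signr_odd -[in RHS]signr_odd.
by case: (odd n); rewrite ?expr0 ?mul1r ?expr1 ?mulN1r ?coefN.
Qed.

(** * The Orlik-Solomon characters when there are no circuits *)

Section FreeOrlikSolomon.
Variables (gT : finGroupType) (G D : {group gT}) (T : finType).
Variables (to : action D T) (M : eqmatroid G to).
Hypothesis freeM : ground M \in indep M.

Lemma os_ideal_free i : os_ideal M i = 0.
Proof.
rewrite /os_ideal big1 // => k _; rewrite big1 // => u _.
by rewrite big_pred0 // => c; rewrite (circuits_free freeM) inE andbF.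
Qed.

Lemma os_char_free i g : g \in G ->
  os_char M i g = ext_trace (to^~ g) (ground M) i.
Proof.
move=> Gg; rewrite cfunE Gg mulr1n.
(* The trace splits over the ideal and the quotient, and the ideal has dimension 0. *)
have := mxtrace_sub_fact_mod (os_ideal_module M i) g.
rewrite {1}/mxtrace big1 ?add0r => [-> | j _]; last first.
  by have := ltn_ord j; rewrite {2}os_ideal_free mxrank0.
rewrite /mxtrace /ext_trace /=.
under eq_bigr do rewrite !mxE.
rewrite -(big_enum_val (fun S : {set T} => sort_sign [seq to x g | x <- enum S] *+
   (uniq [seq to x g | x <- enum S] && ([set x in [seq to x g | x <- enum S]] == S)))) /=.
rewrite big_mkcond [RHS]big_mkcond; apply: eq_bigr => S _.
rewrite inE (map_inj_uniq (act_inj to g)) enum_uniq /=.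
have -> : [set x in [seq to x g | x <- enum S]] = [set to x g | x in S].
  by apply/setP=> x; rewrite inE mem_map_enum.
rewrite andbA; case: (_ && (_ == i)) => //=; by case: eqP.
Qed.

Lemma coef_reversal_eq_char_poly i g : g \in G ->
  (reversal (rk M) (eq_char_poly M))`_i g
  = (-1) ^+ i * ext_trace (to^~ g) (ground M) i.
Proof.
move=> Gg; rewrite coef_poly; case: ltnP => [lt_i | ]; last first.
  by rewrite (rk_free freeM) => /ext_trace_gt->; rewrite mulr0 cfunE.
rewrite coef_sum (bigD1 (Ordinal lt_i)) //= big1 => [|l neq_l]; last first.
  rewrite coefZ coefXn; case: eqP => [e|]; last by rewrite mulr0.
  case/eqP: neq_l; apply: val_inj => /=.
  by apply/eqP; rewrite -(eqn_sub2lE (ltnSE (ltn_ord l)) (ltnSE lt_i)) e.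
by rewrite addr0 coefZ coefXn eqxx mulr1 cfun_signM os_char_free.
Qed.

End FreeOrlikSolomon.

(** * Induction from stabilizers as a sum over fixed points *)

(** The formula for an induced class function averages over [y] in [G]. Such a [y] contributes
    according to whether [g] fixes a translate of [x], and each point of the orbit is reached by one
    coset of the stabilizer, which cancels the factor [1/|H x|]. The function [Phi] gathers all the
    [phi x] into one conjugation-invariant family. *)
Lemma sum_cfInd_orbit_transversal (aT : finGroupType) (D G : {group aT})
    (rT : finType) (to : action D rT) (S : {set rT})
    (H : rT -> {group aT}) (phi : forall x, 'CF(H x))
    (Phi : rT -> aT -> algC) (g : aT) :
  [acts G, on S | to] -> (forall x, H x = 'C_G[x | to]%g :> {set aT}) ->
  (forall x, x \in S -> {in H x, phi x =1 Phi x}) ->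
  (forall x y h, x \in S -> h \in H x -> y \in G ->
     Phi (to x y) (h ^ y)%g = Phi x h) ->
  g \in G ->
  \sum_(x in orbit_transversal to G S) 'Ind[G, H x] (phi x) g
  = \sum_(x in S | to x g == x) Phi x g.
Proof.
move=> actS defH phiE PhiJ Gg; have sGD : G \subset D.
  by case/subsetIP: actS.
have HE x y : y \in G -> (y \in H x) = (to x y == x).
  by move=> Gy; rewrite defH !inE Gy /= (subsetP sGD) //= sub1set inE.
pose E x : algC := if to x g == x then Phi x g else 0.
have [/andP[_ _] sXS injX exX] := orbit_transversalP actS.
move: (orbit_transversal to G S) sXS injX exX => X sXS injX exX.
rewrite big_mkcondr /= (set_partition_big _ (orbit_partition actS)) /=.
have -> : [set orbit to G x | x in S] = [set orbit to G x | x in X].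
  apply/setP=> A; apply/imsetP/imsetP => -[x xS ->].
    have [a Ga xaX] := exX x xS; exists (to x a) => //.
    by rewrite orbit_act_in.
  by exists x; rewrite // (subsetP sXS).
rewrite big_imset /=; last first.
  move=> x y xX yX exy; apply/esym/eqP; rewrite -injX // -exy.
  exact: orbit_refl.
apply: eq_bigr => x xX; have xS := subsetP sXS x xX.
have sHG : H x \subset G by rewrite defH subsetIl.
rewrite cfIndE //; apply: canLR (mulKf _) _; first by rewrite neq0CG.
transitivity (\sum_(y in G) E (to x y)).
  (* After inversion, the conjugate of [g] by [y^-1] lies in [H x] exactly when [g] fixes
     [to x y]. *)
  rewrite (reindex_inj invg_inj) /=; apply: eq_big => [y|y]; first exact: groupV.
  rewrite groupV => Gy; rewrite /E.
  have -> : (to (to x y) g == to x y) = ((g ^ y^-1)%g \in H x).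
    rewrite HE ?groupJ ?groupV // conjgE invgK !actMin ?groupM ?groupV ?(subsetP sGD) //.
    by rewrite -[RHS](inj_eq (act_inj to y)) actKVin ?(subsetP sGD).
  case: ifP => [Hgy | /negbT Hgy]; last by rewrite cfun0.
  by rewrite phiE // -(PhiJ x y _ _ Hgy) // conjgKV.
rewrite (partition_big (to x) (mem (orbit to G x))) /=; last first.
  by move=> y Gy; apply: mem_orbit.
rewrite mulr_sumr; apply: eq_bigr => _ /orbitP[y Gy <-].
under eq_bigr => z /andP[_ /eqP ->] do [].
rewrite sumr_const mulr_natl; congr (_ *+ _).
rewrite -(card_rcoset (H x) y) defH -(amove_act to x sGD Gy).
by apply: eq_card => z; rewrite !inE.
Qed.

(** * Solving the recursion by induction on the ground set *)

Lemma inverse_KL_free (Q : eq_assignment) (gT : finGroupType)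
    (G D : {group gT}) (T : finType) (to : action D T) (M : eqmatroid G to)
    (k : nat) (g : gT) :
  inverse_KL Q -> ground M \in indep M -> g \in G ->
  (Q _ _ _ _ _ M)`_k g = (k == 0%N)%:R * relsign (to^~ g) (ground M).
Proof.
move=> hQ; have [m] := ubnP #|ground M|.
elim: m => // m IHm in gT G D T to M k g * => ltEm freeM Gg.
have sGD := eqm_dom M; have [_ Q0 degQ defQ] := hQ _ _ _ _ _ M.
have rkE := rk_free freeM; set E := ground M in ltEm rkE *.
have [r0 | r_gt0] := posnP (rk M).
  have -> : E = set0 by apply/eqP; rewrite -cards_eq0 -rkE r0.
  rewrite Q0 // coef1 relsign0 mulr1.
  by case: eqP => _; rewrite ?cfunE ?cfun1E ?Gg.
have {}degQ := degQ r_gt0.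
have [ge_k | lt_k] := leqP (rk M) (2 * k).
  rewrite nth_default; last first.
    rewrite leqNgt; apply: contraL ge_k => lt_k; rewrite -ltnNge.
    apply: leq_ltn_trans degQ; rewrite leq_mul2l /=.
    by case: (size _) lt_k.
  rewrite cfunE; case: eqP ge_k => [->|]; last by rewrite mul0r.
  by rewrite muln0 leqNgt r_gt0.
have le_k : (k <= rk M)%N by apply: leq_trans (ltnW lt_k); rewrite leq_pmull.
(* Reversal carries degree [k] to degree [j], which exceeds half the rank because [2 * k < rk M]. *)
pose j := (rk M - k)%N.
have lt_j : (rk M < 2 * j)%N.
  by rewrite mulnBr ltn_subRL [ltnRHS]mul2n -addnn ltn_add2r.
have j_gt0 : (0 < j)%N by case: (j) lt_j => //; rewrite muln0.
have le_j : (j <= rk M)%N := leq_subr _ _.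
have imE h : h \in G -> to^~ h @: E = E.
  move=> Gh; apply/eqP; rewrite eqEcard card_imset ?leqnn ?andbT; last exact: act_inj.
  by apply/subsetP=> _ /imsetP[x xE ->]; rewrite mem_ground_act.
have flE : flats M = powerset E := flats_free freeM.
pose Phi (F : {set T}) h := (-1) ^+ #|F| * relsign (to^~ h) F
                * ((-1) ^+ j * ext_trace (to^~ h) (E :\: F) j).
have PhiE (F : {set T}) h : F \subset E -> h \in 'N_G(F | to)%g ->
    ((-1) ^+ rk (localization M F) * Q _ _ _ _ _ (eqlocalization M F)
     * reversal (rk (contraction M F)) (eq_char_poly (eqcontraction M F)))`_j h
    = Phi F h.
  move=> sFE Nh.
  have [Gh hF] := stab_act Nh.
  rewrite -mulrA coef_signM cfun_signM rk_free ?free_localization //=.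
  rewrite -/E (setIidPr sFE) /Phi -mulrA; congr (_ * _).
  rewrite coefM sum_cfunE.
  have rE l : (reversal (rk (contraction M F)) (eq_char_poly (eqcontraction M F)))`_l h
      = (-1) ^+ l * ext_trace (to^~ h) (E :\: F) l.
    exact: (coef_reversal_eq_char_poly (M := eqcontraction M F)
              (free_contraction freeM sFE) l Nh).
  under eq_bigr do rewrite cfunE rE.
  have [eFE | neq_FE] := eqVneq F E.
    have -> : E :\: F = set0 by rewrite eFE setDv.
    rewrite ext_trace_gt ?cards0 // !mulr0 big1 // => l _.
    have [lt_lj | ge_lj] := ltnP l j.
      by rewrite ext_trace_gt ?mulr0 // cards0 subn_gt0.
    have [_ _ degL _] := hQ _ _ _ _ _ (eqlocalization M F).
    have rkL : rk (localization M F) = rk M.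
      by rewrite rk_free ?free_localization //= -/E (setIidPr sFE) eFE rkE.
    rewrite [_`_l]nth_default ?cfunE ?mul0r //.
    move: degL; rewrite /= rkL => /(_ r_gt0) degL.
    have: ((size (Q _ _ _ _ _ (eqlocalization M F))).-1 < j)%N.
      by rewrite -(@ltn_pmul2l 2) // (ltn_trans degL).
    by move=> lt_j'; apply: leq_trans ge_lj; apply: leq_trans lt_j'; apply: leqSpred.
  have ltF : (#|ground (eqlocalization M F)| < m)%N.
    rewrite /= -/E (setIidPr sFE); apply: (@leq_trans #|E|) => //.
    by apply: proper_card; rewrite properEneq neq_FE.
  rewrite (bigD1 ord0) //= big1 ?addr0 => [|l neq_l]; last first.
    rewrite IHm ?free_localization // -val_eqE in neq_l *.
    by rewrite (negPf neq_l) !mul0r.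
  by rewrite IHm ?free_localization //= mul1r subn0 -/E (setIidPr sFE).
have := congr1 (fun p : {poly 'CF(G)} => p`_j g) defQ.
rewrite coef_signM cfun_signM coef_poly ltnS le_j subKn //.
rewrite coef_sum sum_cfunE.
under eq_bigr do rewrite coef_map_id0 ?linear0 //.
rewrite (@sum_cfInd_orbit_transversal _ _ _ _ _ _
   (fun F => 'N_G(F | to)%G) _ Phi) //.
- rewrite flE sum_relsign_ext_trace ?imE //; last exact: act_inj.
  rewrite -rkE => eqQ; apply: (can_inj (signrMK (rk M))); rewrite eqQ.
  (* If [k = 0] then [j] is the rank and the signs agree; otherwise [j] is smaller and the sum is
     0. *)
  have [k0 | k_gt0] := posnP k; first by rewrite /j k0 subn0 eqxx !mul1r.
  by rewrite ltn_eqF ?mul0r ?mulr0 // -subn_gt0 subKn.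
- apply: (acts_ofP M) (subxx G) _ => h Gh F; rewrite flE !inE => sFE.
  by rewrite -(imE h Gh); apply: imsetS.
- by move=> F /=; rewrite astab1_set.
- by move=> F; rewrite flE inE => sFE h; apply: PhiE.
- move=> F y h; rewrite flE inE => sFE Nh Gy.
  have [Gh hF] := stab_act Nh; rewrite /Phi.
  have eqf : to^~ (h ^ y)%g \o to^~ y =1 to^~ y \o to^~ h.
    have Dh := subsetP sGD h Gh; have Dy := subsetP sGD y Gy.
    by move=> x /=; rewrite -!actMin ?groupJ // -conjgC.
  rewrite (relsign_conj (f := to^~ h)) //; try exact: act_inj.
  rewrite card_setact; congr (_ * (_ * _)).
  rewrite -(ext_trace_conj _ _ (act_inj to h) (act_inj to (h ^ y)%g) (act_inj to y)) //.
  congr ext_trace; rewrite -{1}(imE y Gy); apply/setP=> x.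
  rewrite -(actKVin to (subsetP sGD y Gy) x) inE -[to^*%act F y]/(to^~ y @: F).
  by rewrite !(mem_imset _ _ (act_inj to y)) inE.
Qed.

Theorem theorem3p4 (Q : eq_assignment) (hQ : inverse_KL Q)
    (n : nat) (hn : (1 <= n)%N) :
  Q _ _ _ _ _ (eqboolean n) = (sign_char n)%:P.
Proof.
apply/polyP=> k; apply/cfun_inP=> s Gs.
rewrite inverse_KL_free ?inE // coefC.
case: eqP => _; last by rewrite mul0r cfunE.
rewrite mul1r /sign_char cfunE Gs mulr1n mxtrace_scalar -relsign_perm.
by apply: eq_in_relsign.
Qed.
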